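(* Let $\epsilon_1,\epsilon_2\ge0$ satisfy $2\epsilon_1+2\epsilon_2<1$ and let $C_1',C_2'>0$. There is $c_0>0$ depending only on $\epsilon_1+\epsilon_2$ such that for every $c\in(0,c_0]$ the following holds. Let $d$ be a positive integer, $0<M\le\sqrt{\log(d)}$, $K=c\log(d)/\log(e\log(d)/M^2)$, and let $F:\mathbb R\to\mathbb R$ satisfy $$\|F-F(0)\|_{\infty,[-M,M]}\le C_1'd^{\epsilon_1},\qquad \delta_{K,M}^{-1}\le C_2'd^{\epsilon_2}.$$ Let $y_1,\dots,y_d$ be independent with $y_i\sim\mathcal N(\theta_i,1)$ and let $$\tilde{\mathbf F}=\sum_{i=1}^d\hat P_{K,M}(y_i),\qquad \hat P_{K,M}(u)=\sum_{k=0}^Ka_{k,K,M}H_k(u).$$ Then, with $\mathbf F(\theta)=\sum_{i=1}^dF(\theta_i)$, $$\sup_{\theta\in\Theta_{d,M}}\mathbf E_\theta\big(\tilde{\mathbf F}-\mathbf F(\theta)\big)^2\le C_3'\,d^2\delta_{K,M}^2,$$ where $C_3'>0$ is a constant depending only on $C_1'$ and $C_2'$.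
   Context: $\Theta_{d,M}=\{\theta\in\mathbb R^d:\|\theta\|_\infty\le M\}$. For real $K\ge0$, $\mathcal P_K$ is the set of real polynomials of degree at most $K$; $\|g\|_{\infty,[-M,M]}=\sup_{|x|\le M}|g(x)|$; $P_{K,M}\in\arg\min_{P\in\mathcal P_K}\|F-P\|_{\infty,[-M,M]}$ is a polynomial of best approximation of $F$ on $[-M,M]$, written $P_{K,M}=\sum_{k=0}^Ka_{k,K,M}X^k$ (sums up to a real number $K$ run over integers $k\le K$); $\delta_{K,M}=\|F-P_{K,M}\|_{\infty,[-M,M]}$. The Hermite polynomials are $H_k(x)=(-1)^ke^{x^2/2}\frac{d^k}{dx^k}\big(e^{-x^2/2}\big)$. $\mathbf E_\theta$ is the expectation when the observation is $y=(y_1,\dots,y_d)\sim\mathcal N(\theta,I_d)$. *)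

(* Defs.v *)
From HB Require Import structures.
From mathcomp Require Import all_boot all_order all_algebra.
From mathcomp Require Import all_classical all_reals all_analysis.

Set Implicit Arguments.
Unset Strict Implicit.
Unset Printing Implicit Defensive.

Import Order.TTheory GRing.Theory Num.Theory.
Import numFieldNormedType.Exports.

Local Open Scope classical_set_scope.
Local Open Scope ring_scope.

(* The library's norm on matrices is the max-norm. *)
Definition parameter_space (R : realType) (d : nat) (M : R) : set 'rV[R]_d :=
  [set theta | `|theta| <= M].
Arguments parameter_space {R} d M.

(* Extended-real valued: +oo when g is unbounded on [-M, M]. *)
Definition sup_norm (R : realType) (M : R) (g : R -> R) : \bar R :=
  ereal_sup [set `|g x|%:E | x in [set x : R | `|x| <= M]].

(* [(size P).-1] is the degree of P, with degree 0 for the zero polynomial. *)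
Definition degree_at_most (R : realType) (K : R) : set {poly R} :=
  [set P | ((size P).-1)%:R <= K].

Definition approx_error (R : realType) (M : R) (F : R -> R) (P : {poly R}) :
    \bar R :=
  sup_norm M (fun x => F x - P.[x]).

(* F need not be continuous, so a best approximation need not be unique. *)
Definition best_approximation (R : realType) (K M : R) (F : R -> R)
    (P : {poly R}) : Prop :=
  degree_at_most K P /\
  forall Q, degree_at_most K Q ->
    (approx_error M F P <= approx_error M F Q)%E.

Definition hermite (R : realType) (k : nat) (x : R) : R :=
  (-1) ^+ k * expR (x ^+ 2 / 2)
  * derive1n k (fun u : R => expR (- (u ^+ 2 / 2))) x.

(* For K >= 0, [k < (Num.truncn K).+1] means [k%:R <= K]. *)
Definition hermite_transform (R : realType) (K : R) (P : {poly R}) (u : R) : R :=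
  \sum_(0 <= k < (Num.truncn K).+1) P`_k * hermite k u.

Definition mutually_independent (disp : measure_display)
    (T : measurableType disp) (R : realType) (P : probability T R) (d : nat)
    (y : 'I_d -> {mfun T >-> R}) : Prop :=
  forall (J : {set 'I_d}) (B : 'I_d -> set R),
    (forall i, i \in J -> measurable (B i)) ->
    P [set w | forall i, i \in J -> B i (y i w)]
    = (\prod_(i in J) P (y i @^-1` B i))%E.

Definition has_normal_law (disp : measure_display)
    (T : measurableType disp) (R : realType) (P : probability T R)
    (m s : R) (X : {mfun T >-> R}) : Prop :=
  forall A : set R, measurable A -> distribution P X A = normal_prob m s A.

(* The statistical experiment: [P theta] is the law under which the
   coordinates of the observation y are independent, y_i ~ N(theta_i, 1). *)
Definition gaussian_sequence_model (disp : measure_display)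
    (T : measurableType disp) (R : realType) (d : nat)
    (P : 'rV[R]_d -> probability T R) (y : 'I_d -> {mfun T >-> R}) : Prop :=
  forall theta : 'rV[R]_d,
    mutually_independent (P theta) y /\
    forall i, has_normal_law (P theta) (theta ord0 i) 1 (y i).

Definition additive_functional (R : realType) (d : nat) (F : R -> R)
    (theta : 'rV[R]_d) : R :=
  \sum_(i < d) F (theta ord0 i).

Definition additive_estimator (R : realType) (d : nat) (K : R) (P : {poly R})
    (y : 'I_d -> R) : R :=
  \sum_(i < d) hermite_transform K P (y i).

(* Main.v *)
Require Import Defs.
From HB Require Import structures.
From mathcomp Require Import all_boot all_order all_algebra.
From mathcomp Require Import all_classical all_reals all_analysis.
From mathcomp Require Import measurable_realfun qpoly ring lra.

(** The estimator is unbiased for the sum of the P_K(theta_i), since H_k(y_i)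
    has mean theta_i^k (Stein's identity); so its bias is at most
    [d * delta], and by independence its variance is the sum of the variances
    of the summands.  Stein's identity also gives
    |E H_j(y) H_k(y)| <= (|theta| + sqrt n)^(j+k) for j, k <= n, hence the
    second moment of sum_k b_k H_k(y) is at most
    (sum_k |b_k| (M + sqrt n)^k)^2.  This is applied to the coefficients b_k
    of P_K - F(0), which is bounded by 2 C1 d^eps1 on [-M, M]; Lagrange
    interpolation bounds sum_k |b_k| M^k by e^(2n) times this supremum.  The
    choice of K makes e^(2n) (1 + sqrt n / M)^n at most d^(3c), so the total
    variance is at most 4 C1^2 d^(1 + 2 eps1 + 6c), which is dominated by
    d^2 delta^2 as soon as 6c <= 1 - 2 (eps1 + eps2). *)

Set Implicit Arguments.
Unset Strict Implicit.
Unset Printing Implicit Defensive.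

Import Order.TTheory GRing.Theory Num.Theory.
Import numFieldNormedType.Exports.

Local Open Scope classical_set_scope.
Local Open Scope ring_scope.

(** * Coefficients of polynomials bounded on an interval *)

Section coef_norm.
Variable R : realType.
Implicit Types (p q : {poly R}) (n : nat).

Definition coef_norm n p : R := \sum_(k < n) `|p`_k|.

Lemma coef_norm_ge0 n p : 0 <= coef_norm n p.
Proof. by apply: sumr_ge0 => k _; exact: normr_ge0. Qed.

Lemma coef_normZ n (a : R) p : coef_norm n (a *: p) = `|a| * coef_norm n p.
Proof.
by rewrite /coef_norm mulr_sumr; apply: eq_bigr => k _; rewrite coefZ normrM.
Qed.

Lemma coef_norm_sum n (I : Type) (r : seq I) (P : pred I) (F : I -> {poly R}) :
  coef_norm n (\sum_(i <- r | P i) F i)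
    <= \sum_(i <- r | P i) coef_norm n (F i).
Proof.
rewrite /coef_norm exchange_big /=; apply: ler_sum => k _.
by rewrite coef_sum; exact: ler_norm_sum.
Qed.

Lemma coef_norm_mulXsubC n (c : R) p :
  coef_norm n (('X - c%:P) * p) <= (1 + `|c|) * coef_norm n p.
Proof.
rewrite [leRHS]mulrDl mul1r /coef_norm.
apply: (@le_trans _ _ (\sum_(k < n) (`|('X * p)`_k| + `|c| * `|p`_k|))).
  apply: ler_sum => k _; rewrite mulrBl coefB coefCM -normrM.
  exact: ler_normB.
rewrite big_split /= -mulr_sumr lerD2r.
case: n => [|n]; first by rewrite !big_ord0.
rewrite big_ord_recl big_ord_recr /= coefXM eqxx normr0 add0r.
apply: (@le_trans _ _ (\sum_(i < n) `|p`_i|)); last by rewrite lerDl.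
by apply: ler_sum => i _; rewrite /bump /= add1n coefXM.
Qed.

Lemma coef_norm_prod_XsubC n (I : Type) (r : seq I) (P : pred I) (x : I -> R) :
  coef_norm n (\prod_(i <- r | P i) ('X - (x i)%:P))
    <= \prod_(i <- r | P i) (1 + `|x i|).
Proof.
elim/big_rec2: _ => [|i y1 y2 Pi ih]; last first.
  apply: le_trans (coef_norm_mulXsubC _ _ _) _.
  by apply: ler_wpM2l ih; rewrite addr_ge0.
case: n => [|n]; first by rewrite /coef_norm big_ord0 ler01.
rewrite /coef_norm big_ord_recl coef1 eqxx normr1 big1 ?addr0// => i _.
by rewrite coef1 /bump normr0.
Qed.

Lemma prod_dist_ord n (j : 'I_n.+1) :
  \prod_(i < n.+1 | i != j) `|j%:R - i%:R| = (j`! * (n - j)`!)%:R :> R.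
Proof.
have jn : (j <= n)%N by rewrite -ltnS.
transitivity (\prod_(0 <= i < n.+1 | i != j) (`|j%:R - i%:R| : R)).
  by rewrite big_mkord.
rewrite (@big_cat_nat _ _ _ j) ?(leq_trans jn)//=.
rewrite [X in _ * X]big_ltn_cond ?ltnS// eqxx /= natrM; congr (_ * _).
  transitivity (\prod_(0 <= i < j) (`|j%:R - i%:R| : R)).
    rewrite big_nat_cond [RHS]big_nat_cond; apply: eq_bigl => i.
    by rewrite andbT; case: ltngtP; rewrite ?andbF.
  rewrite fact_prod natr_prod big_nat_rev /= big_add1 /=.
  apply: eq_big_nat => i /andP[_ ij].
  by rewrite add0n natrB// opprB addrC subrK normr_nat.
transitivity (\prod_(j.+1 <= i < n.+1) (`|j%:R - i%:R| : R)).
  rewrite big_nat_cond [RHS]big_nat_cond; apply: eq_bigl => i.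
  by rewrite andbT; case: (ltngtP i j) => _; rewrite /= ?andbF ?andbT.
rewrite fact_prod natr_prod -[j.+1]add1n big_addn subSn//.
apply: eq_big_nat => i _.
by rewrite natrD opprD addrCA subrr addr0 normrN normr_nat.
Qed.

Lemma exprn_fact_le_expR n (x : R) : 0 <= x -> x ^+ n <= n`!%:R * expR x.
Proof.
move=> x0; case: n => [|n].
  by rewrite expr0 fact0 mul1r; rewrite -expR0 ler_expR.
rewrite mulrC -ler_pdivrMr ?ltr0n ?fact_gt0//.
by apply: le_trans (expR_ge1Dxn n x0); rewrite lerDr.
Qed.

(* Lagrange interpolation at the equispaced nodes [-1 + 2 j / n]. *)
Lemma coef_norm_le_sup n p (A : R) : (size p <= n.+1)%N ->
  (forall x, `|x| <= 1 -> `|p.[x]| <= A) ->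
  coef_norm n.+1 p <= A * expR (2 * n%:R).
Proof.
move=> sp pA.
case: n sp => [|n] sp.
  rewrite mulr0 expR0 mulr1 /coef_norm big_ord_recl big_ord0 addr0.
  by rewrite -horner_coef0 pA// normr0.
set N := n.+1 in sp *.
have N0 : (0 : R) < N%:R by rewrite ltr0n.
have A0 : 0 <= A by apply: le_trans (pA 0 _); rewrite ?normr0.
pose x (i : nat) : R := -1 + 2 * i%:R / N%:R.
have xinj : injective x.
  move=> i j /addrI /(mulIf (invr_neq0 (lt0r_neq0 N0))) /mulfI ij.
  by apply/eqP; rewrite -(eqr_nat R); apply/eqP/ij.
have x1 (i : 'I_N.+1) : `|x i| <= 1.
  have iN : (i%:R : R) <= N%:R by rewrite ler_nat -ltnS.
  rewrite ler_norml /x; apply/andP; split.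
    by rewrite lerDl mulr_ge0// invr_ge0 ler0n.
  by rewrite -lerBrDl opprK ler_pdivrMr// -[1 + 1]/2 ler_pM2l.
pose D (i : 'I_N.+1) := \prod_(j < N.+1 | j != i) ('X - (x j)%:P).
have DE (i : 'I_N.+1) :
    `|(D i).[x i]| = (2 / N%:R) ^+ N * (i`! * (N - i)`!)%:R.
  rewrite /D horner_prod normr_prod -prod_dist_ord.
  have -> : (2 / N%:R : R) ^+ N = \prod_(j < N.+1 | j != i) (2 / N%:R).
    by rewrite prodr_const cardC1 card_ord.
  rewrite -big_split /=; apply: eq_bigr => j _.
  rewrite hornerXsubC /x opprD addrACA subrr add0r -mulrBl -mulrBr.
  by rewrite !normrM normfV [in LHS]ger0_norm// (ger0_norm (ltW N0)) mulrAC.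
have Dn (i : 'I_N.+1) : coef_norm N.+1 (D i) <= 2 ^+ N.
  apply: le_trans (coef_norm_prod_XsubC _ _ _ _) _.
  have -> : 2 ^+ N = \prod_(j < N.+1 | j != i) (2 : R).
    by rewrite prodr_const cardC1 card_ord.
  apply: ler_prod => j _; rewrite addr_ge0//=.
  by rewrite -[2]/(1 + 1) lerD2l.
rewrite (lagrange_gen _ xinj sp)//.
apply: le_trans (coef_norm_sum _ _ _ _) _.
pose B : R := 2 ^+ N * (N%:R / 2) ^+ N.
apply: (@le_trans _ _ (\sum_(i < N.+1) A * (B / N`!%:R * 'C(N, i)%:R))).
  apply: ler_sum => i _; rewrite lagrangeE//= !mul_polyC !coef_normZ.
  rewrite ler_pM ?pA ?mulr_ge0 ?coef_norm_ge0//.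
  rewrite normfV DE; apply: (@le_trans _ _
    (((2 / N%:R) ^+ N * (i`! * (N - i)`!)%:R)^-1 * 2 ^+ N)).
    by apply: ler_wpM2l (Dn i); rewrite invr_ge0 mulr_ge0 ?exprn_ge0 ?divr_ge0.
  rewrite le_eqVlt; apply/orP; left; apply/eqP.
  have iN : (i <= N)%N by rewrite -ltnS.
  rewrite /B -(bin_fact iN) !natrM.
  rewrite !expr_div_n.
  have f0 k : (k`!%:R : R) != 0 by rewrite pnatr_eq0 -lt0n fact_gt0.
  have b0 : ('C(N, i)%:R : R) != 0 by rewrite pnatr_eq0 -lt0n bin_gt0.
  by field; rewrite !f0 b0 !expf_neq0 ?lt0r_neq0.
rewrite -mulr_sumr -mulr_sumr -natr_sum.
have -> : (\sum_(i < N.+1) 'C(N, i) = 2 ^ N)%N.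
  by rewrite -[2%N]/(1 + 1)%N expnDn; apply: eq_bigr => i _; rewrite !exp1n !muln1.
apply: ler_wpM2l => //.
have -> : B / N`!%:R * (2 ^ N)%:R = 2 ^+ N * (N%:R ^+ N / N`!%:R).
  rewrite /B natrX expr_div_n; field.
  by rewrite pnatr_eq0 -lt0n fact_gt0 expf_neq0.
rewrite mulrDl mul1r expRD; apply: ler_pM.
- by rewrite exprn_ge0.
- by rewrite divr_ge0// exprn_ge0.
- rewrite -[X in expR X]mul1r expRM_natr.
  rewrite lerXn2r ?nnegrE ?expR_ge0//.
  exact: le_trans (expR_ge1Dx 1).
- rewrite ler_pdivrMr ?ltr0n ?fact_gt0// mulrC.
  exact: exprn_fact_le_expR.
Qed.

End coef_norm.

(** * Gaussian moments and Hermite polynomials *)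

Section gauss.
Variable R : realType.
Implicit Types (p q : {poly R}) (m x : R).
Local Notation mu := (@lebesgue_measure R).

Lemma normal_pdf1E m x :
  normal_pdf m 1 x = normal_peak 1 * expR (- ((x - m) ^+ 2 / 2)).
Proof. by rewrite normal_pdfE ?oner_neq0// /normal_fun expr1n mulNr. Qed.

Lemma expR_normal_pdf s m x :
  expR (s * x) * normal_pdf m 1 x
  = expR (s * m + s ^+ 2 / 2) * normal_pdf (m + s) 1 x.
Proof.
rewrite !normal_pdf1E ![_ * (normal_peak 1 * _)]mulrCA -!expRD.
by congr (_ * expR _); field.
Qed.

Lemma normr_exprn_le_expR x k : `|x| ^+ k <= k`!%:R * (expR x + expR (- x)).
Proof.
apply: le_trans (exprn_fact_le_expR k (normr_ge0 x)) _.
rewrite ler_wpM2l//; case: (ger0P x) => _.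
  by rewrite lerDl expR_ge0.
by rewrite lerDr expR_ge0.
Qed.

Lemma poly_normal_pdf_le p m : exists2 C, 0 <= C & forall x,
  `|p.[x] * normal_pdf m 1 x|
    <= C * (normal_pdf (m + 1) 1 x + normal_pdf (m - 1) 1 x).
Proof.
pose S : R := \sum_(k < size p) `|p`_k| * k`!%:R.
pose D : R := Num.max (expR (m + 2^-1)) (expR (- m + 2^-1)).
have S0 : 0 <= S by apply: sumr_ge0 => k _; rewrite mulr_ge0.
have D0 : 0 <= D by rewrite le_max expR_ge0.
exists (S * D); first exact: mulr_ge0.
move=> x; rewrite normrM (ger0_norm (normal_pdf_ge0 _ _ _)).
apply: (@le_trans _ _ (S * (expR x + expR (- x)) * normal_pdf m 1 x)).
  apply: ler_wpM2r; first exact: normal_pdf_ge0.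
  rewrite horner_coef mulr_suml; apply: le_trans (ler_norm_sum _ _ _) _.
  apply: ler_sum => k _; rewrite normrM normrX -mulrA ler_wpM2l//.
  exact: normr_exprn_le_expR.
rewrite -!mulrA; apply: ler_wpM2l => //.
have := expR_normal_pdf 1 m x; have := expR_normal_pdf (-1) m x.
rewrite !mul1r !mulN1r sqrrN expr1n mul1r mulrDl => -> ->.
rewrite mulrDr; apply: lerD; apply: ler_wpM2r; rewrite ?normal_pdf_ge0//.
  by rewrite /D le_max lexx.
by rewrite /D le_max lexx orbT.
Qed.

Lemma integrable_poly_normal_pdf p m :
  mu.-integrable setT (EFin \o (fun x => p.[x] * normal_pdf m 1 x)).
Proof.
have [C C0 Cp] := poly_normal_pdf_le p m.
apply: (@le_integrable _ _ _ mu _ _ _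
  (EFin \o (fun x => C * (normal_pdf (m + 1) 1 x + normal_pdf (m - 1) 1 x)))) => //.
- apply/measurable_EFinP/measurable_funM; first exact: measurable_poly.
  exact: measurable_normal_pdf.
- move=> x _; rewrite /= lee_fin; apply: le_trans (Cp x) _; exact: ler_norm.
- have -> : EFin \o (fun x => C * (normal_pdf (m + 1) 1 x + normal_pdf (m - 1) 1 x)) =
    (fun x => C%:E * ((normal_pdf (m + 1) 1 x)%:E + (normal_pdf (m - 1) 1 x)%:E))%E.
    by apply/funext => x /=; rewrite EFinM EFinD.
  apply: integrableZl => //; apply: integrableD => //; exact: integrable_normal_pdf.
Qed.

Lemma poly_normal_pdf_decay p m : exists B, forall x,
  `|x| * `|p.[x] * normal_pdf m 1 x| <= B.
Proof.
have [C C0 Cp] := poly_normal_pdf_le ('X * p) m.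
exists (C * (normal_peak 1 + normal_peak 1)) => x.
have := Cp x; rewrite hornerM hornerX -mulrA normrM => /le_trans; apply.
by apply: ler_wpM2l => //; apply: lerD; apply: normal_pdf_ub; rewrite oner_neq0.
Qed.

Lemma is_derive_poly_normal_pdf p m x :
  is_derive x (1 : R) (fun u => p.[u] * normal_pdf m 1 u)
    (- ((('X - m%:P) * p - p^`()).[x] * normal_pdf m 1 x)).
Proof.
have -> : (fun u => p.[u] * normal_pdf m 1 u) =
  (fun u => p.[u] * (normal_peak 1 * expR (- ((u - m) ^+ 2 / 2)))).
  by apply/funext => u; rewrite normal_pdf1E.
apply: is_derive_eq.
rewrite normal_pdf1E !hornerE /GRing.scale /=.
by field.
Qed.

Lemma stein_normal_pdf p m :
  (\int[mu]_x ((('X - m%:P) * p - p^`()).[x] * normal_pdf m 1 x)%:E = 0)%E.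
Proof.
pose g x := (('X - m%:P) * p - p^`()).[x] * normal_pdf m 1 x.
pose G x := - (p.[x] * normal_pdf m 1 x).
have dG x : is_derive x (1 : R) G (g x).
  have := is_derive_poly_normal_pdf p m x => h.
  rewrite /g -[X in is_derive _ _ _ X]opprK; exact: is_deriveN.
have gi : mu.-integrable setT (EFin \o g) by exact: integrable_poly_normal_pdf.
have cg : continuous g.
  move=> x; apply: cvgM; first exact: continuous_horner.
  by apply: continuous_normal_pdf; rewrite oner_neq0.
have cG x : {for x, continuous G}.
  by apply/differentiable_continuous/derivable1_diffP; case: (dG x).
pose I n := `[- n.+1%:R, n.+1%:R : R].
have FTC n : (\int[mu]_(x in [set` I n]) (g x)%:E
              = (G n.+1%:R - G (- n.+1%:R))%:E)%E.
  rewrite EFinB; apply: continuous_FTC2.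
  - by rewrite (@lt_trans _ _ 0) ?oppr_lt0 ?ltr0n.
  - exact: continuous_subspaceT.
  - split.
    + by move=> x _; case: (dG x).
    + exact/cvg_at_right_filter/cG.
    + exact/cvg_at_left_filter/cG.
  - by move=> x _; rewrite derive1E derive_val.
have [B GB] := poly_normal_pdf_decay p m.
have B0 : 0 <= B by apply: le_trans (GB 0); rewrite mulr_ge0.
have lim0 : (G n.+1%:R - G (- n.+1%:R))%:E @[n --> \oo] --> 0%E.
  apply: cvg_EFin; first exact: nearW.
  have GB' x n : `|x| = n.+1%:R -> `|G x| <= B * n.+1%:R^-1.
    move=> xn; rewrite normrN ler_pdivlMr ?ltr0n// mulrC -xn; exact: GB.
  apply: (@squeeze_cvgr _ _ _ _ (fun n => - ((B + B) * harmonic n))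
                                (fun n => (B + B) * harmonic n)).
  - apply: nearW => n; rewrite -ler_norml mulrDl /harmonic.
    apply: le_trans (ler_normB _ _) _; apply: lerD; apply: GB'.
      by rewrite normr_nat.
    by rewrite normrN normr_nat.
  - rewrite -oppr0 -(mulr0 (B + B)); apply: cvgN; apply: cvgMr.
    exact: cvg_harmonic.
  - rewrite -(mulr0 (B + B)); apply: cvgMr; exact: cvg_harmonic.
have limI : (\int[mu]_(x in [set` I n]) (g x)%:E)%E @[n --> \oo]
    --> (\int[mu]_x (g x)%:E)%E.
  under eq_fun do rewrite integral_mkcond.
  have [] // := @dominated_convergence _ _ _ mu setT measurableT
    (fun n => (EFin \o g) \_ [set` I n]) (EFin \o g) (abse \o (EFin \o g)).
  - move=> n; apply/(measurable_restrict _ _ _).1 => //.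
    by apply: measurable_funTS; exact: (measurable_int _ gi).
  - exact: (measurable_int _ gi).
  - apply: aeW => x _; apply: cvg_near_cst.
    near=> n; rewrite patchE mem_set// /I /= in_itv/= -ler_norml.
    near: n; have /archi_boundP := normr_ge0 x; set N := Num.bound _ => xN.
    exists N => // n /= Nn; apply: ltW; apply: lt_le_trans xN _.
    by rewrite ler_nat (leq_trans Nn).
  - exact: integrable_abse.
  - by apply: aeW => x n _; rewrite patchE; case: ifP => // _; rewrite abse0 abse_ge0.
have : (\int[mu]_(x in [set` I n]) (g x)%:E)%E @[n --> \oo] --> 0%E.
  by under eq_fun do rewrite FTC.
exact: cvg_unique limI.
Unshelve. all: by end_near.
Qed.
End gauss.

Section gauss_moments.
Variable R : realType.
Implicit Types (p q : {poly R}) (m x : R).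
Local Notation mu := (@lebesgue_measure R).
Local Notation gauss m := (normal_prob m 1).

Lemma ae_eq_normal_density m : ae_eq mu setT
  (Radon_Nikodym_SigmaFinite.f (gauss m) mu)
  (fun x => (normal_pdf m 1 x)%:E).
Proof.
have dom : gauss m `<< mu by exact: normal_prob_dominates.
apply: integral_ae_eq => //.
- exact: Radon_Nikodym_SigmaFinite.f_integrable.
- by apply/measurable_EFinP; exact: measurable_normal_pdf.
- by move=> A _ mA; rewrite -Radon_Nikodym_SigmaFinite.f_integral.
Qed.

Lemma ge0_integral_normal_prob m (f : R -> \bar R) :
  measurable_fun setT f -> (forall x, (0 <= f x)%E) ->
  (\int[gauss m]_x f x = \int[mu]_x (f x * (normal_pdf m 1 x)%:E))%E.
Proof.
move=> mf f0; have dom : gauss m `<< mu by exact: normal_prob_dominates.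
rewrite -(Radon_Nikodym_SigmaFinite.change_of_variables dom)//.
apply: ae_eq_integral => //.
- apply: emeasurable_funM => //; apply: (measurable_int mu).
  exact: Radon_Nikodym_SigmaFinite.f_integrable.
- apply: emeasurable_funM => //; apply/measurable_EFinP.
  exact: measurable_normal_pdf.
- by apply: ae_eqe_mul2l; exact: ae_eq_normal_density.
Qed.

Lemma integrable_poly_normal_prob p m :
  (gauss m).-integrable setT (EFin \o horner p).
Proof.
have mp : measurable_fun setT (EFin \o horner p).
  by apply/measurable_EFinP; exact: measurable_poly.
apply/integrableP; split => //.
rewrite ge0_integral_normal_prob//; last exact: measurableT_comp.
have /integrableP[_] := integrable_poly_normal_pdf p m.
congr (_ < _)%E; apply: eq_integral => x _ /=.
by rewrite normrM (ger0_norm (normal_pdf_ge0 _ _ _)).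
Qed.

Lemma integral_normal_prob_poly p m :
  (\int[gauss m]_x (p.[x])%:E = \int[mu]_x (p.[x] * normal_pdf m 1 x)%:E)%E.
Proof.
have dom : gauss m `<< mu by exact: normal_prob_dominates.
rewrite -(Radon_Nikodym_change_of_variables dom)//; last first.
  exact: integrable_poly_normal_prob.
under [RHS]eq_integral do rewrite EFinM.
have mp : measurable_fun setT (fun x => (p.[x])%:E).
  by apply/measurable_EFinP; exact: measurable_poly.
apply: ae_eq_integral => //.
- by apply: emeasurable_funM.
- apply: emeasurable_funM => //; apply/measurable_EFinP.
  exact: measurable_normal_pdf.
- apply: ae_eqe_mul2l.
  apply: ae_eq_trans (ae_eq_normal_density m).
  exact/ae_eq_sym/ae_eq_Radon_Nikodym_SigmaFinite.
Qed.

Definition gauss_mean m p : R := \int[gauss m]_x p.[x].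

Lemma gauss_meanE m p : (\int[gauss m]_x (p.[x])%:E)%E = (gauss_mean m p)%:E.
Proof.
rewrite /gauss_mean /Rintegral fineK//; apply: integrable_fin_num => //.
exact: integrable_poly_normal_prob.
Qed.

Lemma gauss_mean1 m : gauss_mean m 1 = 1.
Proof.
apply: EFin_inj; rewrite -gauss_meanE integral_normal_prob_poly.
under eq_integral do rewrite hornerC mul1r.
exact: integral_normal_pdf.
Qed.

Lemma gauss_meanD m p q : gauss_mean m (p + q) = gauss_mean m p + gauss_mean m q.
Proof.
rewrite /gauss_mean -RintegralD//; try exact: integrable_poly_normal_prob.
by apply: eq_Rintegral => x _; rewrite hornerD.
Qed.

Lemma gauss_meanZ m (a : R) p : gauss_mean m (a *: p) = a * gauss_mean m p.
Proof.
rewrite /gauss_mean -RintegralZl//; last exact: integrable_poly_normal_prob.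
by apply: eq_Rintegral => x _; rewrite hornerZ.
Qed.

Lemma gauss_meanB m p q : gauss_mean m (p - q) = gauss_mean m p - gauss_mean m q.
Proof. by rewrite gauss_meanD -scaleN1r gauss_meanZ mulN1r. Qed.

Lemma gauss_meanC m (a : R) : gauss_mean m a%:P = a.
Proof. by rewrite -[a%:P]mulr1 mul_polyC gauss_meanZ gauss_mean1 mulr1. Qed.

Lemma gauss_mean_sum m (I : Type) (r : seq I) (P : pred I) (F : I -> {poly R}) :
  gauss_mean m (\sum_(i <- r | P i) F i) = \sum_(i <- r | P i) gauss_mean m (F i).
Proof.
apply: (big_morph (gauss_mean m)); first exact: gauss_meanD.
by rewrite -polyC0 gauss_meanC.
Qed.

Lemma gauss_mean_stein m p :
  gauss_mean m ('X * p - p^`()) = m * gauss_mean m p.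
Proof.
apply/eqP; rewrite -subr_eq0 -gauss_meanZ -gauss_meanB.
have -> : 'X * p - p^`() - m *: p = ('X - m%:P) * p - p^`().
  by rewrite mulrBl mul_polyC addrAC.
apply/eqP; apply: EFin_inj.
by rewrite -gauss_meanE integral_normal_prob_poly stein_normal_pdf.
Qed.

End gauss_moments.
Arguments gauss_mean {R} m p.

Section hermite_poly.
Variable R : realType.
Implicit Types (p q : {poly R}) (m x : R).

Fixpoint hermite_poly (k : nat) : {poly R} :=
  if k is j.+1 then 'X * hermite_poly j - (hermite_poly j)^`() else 1.

Lemma deriv_hermite_poly k :
  (hermite_poly k.+1)^`() = k.+1%:R *: hermite_poly k.
Proof.
elim: k => [|k ih].
  by rewrite /= mulr1 -polyC1 derivC subr0 derivX scale1r.
have -> : hermite_poly k.+2 = 'X * hermite_poly k.+1 - (hermite_poly k.+1)^`().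
  by [].
rewrite derivB derivM derivX mul1r ih derivZ -scalerAr -addrA -scalerBr.
by rewrite -/(hermite_poly k.+1) -[k.+2%:R]natr1 addrC scalerDl scale1r.
Qed.

Lemma gauss_mean_hermite m k : gauss_mean m (hermite_poly k) = m ^+ k.
Proof.
elim: k => [|k ih]; first by rewrite gauss_mean1.
by rewrite /= gauss_mean_stein ih exprS.
Qed.

Lemma gauss_mean_hermiteM m j k :
  gauss_mean m (hermite_poly k.+1 * hermite_poly j)
  = m * gauss_mean m (hermite_poly k * hermite_poly j)
    + gauss_mean m (hermite_poly k * (hermite_poly j)^`()).
Proof.
rewrite -gauss_mean_stein -gauss_meanD; congr (gauss_mean m).
by rewrite /= derivM; ring.
Qed.

Lemma normr_gauss_mean_hermiteM m n j k : (j <= n)%N -> (k <= n)%N ->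
  `|gauss_mean m (hermite_poly k * hermite_poly j)|
    <= (`|m| + Num.sqrt n%:R) ^+ (k + j).
Proof.
set s := Num.sqrt _; set b := _ + s.
have s0 : 0 <= s by exact: sqrtr_ge0.
have b0 : 0 <= b by exact: addr_ge0.
have sb : s <= b by rewrite lerDr.
have s2 : s ^+ 2 = n%:R by rewrite sqr_sqrtr.
elim: k j => [|k ih] j jn kn.
  rewrite mul1r gauss_mean_hermite normrX add0n.
  by rewrite lerXn2r ?nnegrE// lerDl.
have {}ih := fun i (h : (i <= n)%N) => ih i h (ltnW kn).
rewrite gauss_mean_hermiteM; apply: le_trans (ler_normD _ _) _.
rewrite addSn exprS mulrDl normrM; apply: lerD.
  by apply: ler_wpM2l => //; exact: ih.
case: j jn => [|j] jn.
  rewrite derivC mulr0 -polyC0 gauss_meanC normr0.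
  by rewrite mulr_ge0// exprn_ge0.
rewrite deriv_hermite_poly -scalerAr gauss_meanZ normrM normr_nat.
apply: (@le_trans _ _ (s ^+ 2 * b ^+ (k + j))).
  by apply: ler_pM; rewrite ?s2 ?ler_nat// ih// ltnW.
rewrite expr2 addnS exprS -mulrA; apply: ler_wpM2l => //.
by apply: ler_wpM2r => //; rewrite exprn_ge0.
Qed.

End hermite_poly.

Section hermite.
Variable R : realType.
Implicit Types (p q : {poly R}) (m x : R).

Lemma derive1n_gauss k (x : R) :
  derive1n k (fun u : R => expR (- (u ^+ 2 / 2))) x
  = (-1) ^+ k * (hermite_poly R k).[x] * expR (- (x ^+ 2 / 2)).
Proof.
elim: k x => [|k ih] x; first by rewrite derive1n0 expr0 hornerC !mul1r.
rewrite derive1nS (_ : derive1n k _ = fun u =>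
  (-1) ^+ k * (hermite_poly R k).[u] * expR (- (u ^+ 2 / 2))); last first.
  exact/funext.
rewrite derive1E; set p := hermite_poly R k.
have -> : hermite_poly R k.+1 = 'X * p - p^`() by [].
apply: derive_val.
apply: is_derive_eq.
by rewrite !hornerE /GRing.scale /= (exprS _ k); field.
Qed.

Lemma hermiteE k (x : R) : hermite k x = (hermite_poly R k).[x].
Proof.
rewrite /hermite derive1n_gauss mulrACA -expRD addrN expR0 mulr1.
by rewrite mulrA -exprMn mulrN1 opprK expr1n mul1r.
Qed.

Definition hermite_transform_poly n p : {poly R} :=
  \sum_(k < n) p`_k *: hermite_poly R k.

Lemma hermite_transformE (K : R) p (u : R) :
  hermite_transform K p u =
  (hermite_transform_poly (Num.truncn K).+1 p).[u].
Proof.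
rewrite /hermite_transform big_mkord horner_sum; apply: eq_bigr => k _.
by rewrite hornerZ hermiteE.
Qed.

Lemma hermite_transform_polyD n p q : hermite_transform_poly n (p + q) =
  hermite_transform_poly n p + hermite_transform_poly n q.
Proof.
by rewrite -big_split; apply: eq_bigr => k _; rewrite coefD scalerDl.
Qed.

Lemma hermite_transform_polyC n (a : R) :
  hermite_transform_poly n.+1 a%:P = a%:P.
Proof.
rewrite /hermite_transform_poly big_ord_recl coefC eqxx big1 ?addr0.
  by rewrite alg_polyC.
by move=> k _; rewrite coefC /= scale0r.
Qed.

Lemma gauss_mean_hermite_transform m n p : (size p <= n)%N ->
  gauss_mean m (hermite_transform_poly n p) = p.[m].
Proof.
move=> pn; rewrite gauss_mean_sum (horner_coef_wide _ pn).
by apply: eq_bigr => k _; rewrite gauss_meanZ gauss_mean_hermite.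
Qed.

Lemma gauss_mean_hermite_transform_sqr_le m n p :
  gauss_mean m (hermite_transform_poly n.+1 p ^+ 2)
  <= (\sum_(k < n.+1) `|p`_k| * (`|m| + Num.sqrt n%:R) ^+ k) ^+ 2.
Proof.
rewrite !expr2 /hermite_transform_poly mulr_suml gauss_mean_sum mulr_suml.
apply: ler_sum => k _; rewrite !mulr_sumr gauss_mean_sum.
apply: ler_sum => j _; rewrite -scalerAl -scalerAr scalerA gauss_meanZ.
apply: le_trans (ler_norm _) _; rewrite !normrM mulrACA -exprD.
by apply: ler_wpM2l; [exact: mulr_ge0|apply: normr_gauss_mean_hermiteM; rewrite -ltnS].
Qed.

(* The factor [(1 + sqrt n / M)^n] is [((M + sqrt n) / M)^n], the ratio
   between the growth of the second moments and that of the coefficients. *)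
Lemma hermite_transform_sqr_bound m (M : R) n p (A : R) :
  (size p <= n.+1)%N -> 0 < M -> `|m| <= M ->
  (forall x, `|x| <= M -> `|p.[x]| <= A) ->
  gauss_mean m (hermite_transform_poly n.+1 p ^+ 2)
  <= (A * expR (2 * n%:R) * (1 + Num.sqrt n%:R / M) ^+ n) ^+ 2.
Proof.
move=> pn M0 mM pA; apply: le_trans (gauss_mean_hermite_transform_sqr_le _ _ _) _.
set s := Num.sqrt _; have s0 : 0 <= s := sqrtr_ge0 _.
set c := 1 + s / M.
have c1 : 1 <= c by rewrite lerDl divr_ge0// ltW.
have c0 : 0 <= c by rewrite (le_trans _ c1).
have sum0 : 0 <= \sum_(k < n.+1) `|p`_k| * (`|m| + s) ^+ k.
  by apply: sumr_ge0 => k _; rewrite mulr_ge0// exprn_ge0// addr_ge0.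
have A0 : 0 <= A by apply: le_trans (pA 0 _); rewrite ?normr0// ltW.
rewrite lerXn2r ?nnegrE ?mulr_ge0 ?expR_ge0 ?exprn_ge0//.
pose q := p \Po (M *: 'X).
have qk k : q`_k = p`_k * M ^+ k.
  rewrite /q comp_polyE coef_sum.
  under eq_bigr => i _ do rewrite exprZn scalerA coefZ coefXn.
  have [kp|pk] := ltnP k (size p).
    rewrite (bigD1 (Ordinal kp))//= eqxx mulr1 big1 ?addr0// => i ik.
    by rewrite -val_eqE /= eq_sym in ik; rewrite (negbTE ik) mulr0.
  rewrite nth_default// mul0r big1// => i _.
  by rewrite gtn_eqF ?mulr0// (leq_trans (ltn_ord i)).
have sq : (size q <= n.+1)%N.
  by apply/leq_sizeP => k nk; rewrite qk nth_default ?mul0r// (leq_trans pn).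
have qA (x : R) : `|x| <= 1 -> `|q.[x]| <= A.
  move=> x1; rewrite horner_comp hornerZ hornerX; apply: pA.
  by rewrite normrM gtr0_norm// ler_piMr// ltW.
have := coef_norm_le_sup sq qA; rewrite /coef_norm => qn.
apply: (@le_trans _ _ ((\sum_(k < n.+1) `|q`_k|) * c ^+ n)); last first.
  by apply: ler_wpM2r; rewrite ?exprn_ge0.
rewrite mulr_suml; apply: ler_sum => k _.
rewrite qk normrM -mulrA; apply: ler_wpM2l => //.
rewrite (ger0_norm (exprn_ge0 _ (ltW M0))).
apply: (@le_trans _ _ (M ^+ k * c ^+ k)).
  rewrite -exprMn lerXn2r ?nnegrE ?addr_ge0 ?mulr_ge0 ?(ltW M0)//.
  by rewrite /c mulrDr mulr1 mulrCA divff ?gt_eqF// mulr1 lerD2r.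
apply: ler_wpM2l; first by rewrite exprn_ge0// ltW.
by apply: ler_weXn2l => //; rewrite -ltnS.
Qed.

End hermite.

(** * Independent Gaussian observations *)

Section has_mean.
Context (disp : measure_display) (T : measurableType disp) (R : realType)
  (P : probability T R).
Implicit Types (f g : T -> R) (a b : R).

Definition has_mean f a :=
  P.-integrable setT (EFin \o f) /\ (\int[P]_w (f w)%:E = a%:E)%E.

Lemma has_mean_cst a : has_mean (fun=> a) a.
Proof.
split; first exact: finite_measure_integrable_cst.
by rewrite integral_cst// [X in (_ * X)%E]probability_setT mule1.
Qed.

Lemma has_meanD f g a b :
  has_mean f a -> has_mean g b -> has_mean (fun w => f w + g w) (a + b).
Proof.
move=> [fi fa] [gi gb]; split; first exact: (integrableD measurableT fi gi).
by rewrite EFinD -fa -gb -(integralD measurableT fi gi).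
Qed.

Lemma has_meanZ c f a : has_mean f a -> has_mean (fun w => c * f w) (c * a).
Proof.
move=> [fi fa]; split; first exact: (integrableZl measurableT c fi).
by rewrite EFinM -fa -(integralZl measurableT fi).
Qed.

Lemma has_mean_sum (I : Type) (r : seq I) (Q : pred I) (f : I -> T -> R)
    (a : I -> R) : (forall i, Q i -> has_mean (f i) (a i)) ->
  has_mean (fun w => \sum_(i <- r | Q i) f i w) (\sum_(i <- r | Q i) a i).
Proof.
move=> fa; elim: r => [|i r ih].
  under eq_fun do rewrite big_nil; rewrite big_nil; exact: has_mean_cst.
under eq_fun do rewrite big_cons; rewrite big_cons.
by case: ifPn => Qi //; apply: has_meanD => //; exact: fa.
Qed.

Lemma expectation_has_mean f a : has_mean f a -> ('E_P[f] = a%:E)%E.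
Proof. by rewrite unlock => -[]. Qed.

End has_mean.

Section gaussian_means.
Context (disp : measure_display) (T : measurableType disp) (R : realType)
  (P : probability T R).
Implicit Types (p q : {poly R}) (m : R).

(* [normal_prob] lives on [measurableTypeR R] and distributions on [R]: the
   two measurable structures agree but have different displays. *)
Let idR : measurableTypeR R -> R := idfun.

Let measurable_idR : measurable_fun setT idR.
Proof. by move=> _ A mA; rewrite setTI. Qed.

Lemma integral_distribution_normal m (X : {mfun T >-> R}) (f : R -> \bar R) :
  has_normal_law P m 1 X ->
  (\int[distribution P X]_x f x
   = \int[pushforward (normal_prob m 1) idR]_x f x)%E.
Proof. by move=> hX; apply: eq_measure_integral => A mA _; exact: hX. Qed.

Lemma ge0_integral_normal_law m (X : {mfun T >-> R}) (f : R -> \bar R) :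
  has_normal_law P m 1 X -> measurable_fun setT f -> (forall x, (0 <= f x)%E) ->
  (\int[P]_w f (X w) = \int[normal_prob m 1]_x f x)%E.
Proof.
move=> hX mf f0; rewrite -[LHS](ge0_integral_distribution X mf f0).
by rewrite (integral_distribution_normal _ hX) ge0_integral_pushforward.
Qed.

Lemma has_mean_normal_law m (X : {mfun T >-> R}) p :
  has_normal_law P m 1 X -> has_mean P (fun w => p.[X w]) (gauss_mean m p).
Proof.
move=> hX.
have mp : measurable_fun setT (EFin \o horner p).
  by apply/measurable_EFinP; exact: measurable_poly.
have ip : P.-integrable setT ((EFin \o horner p) \o X).
  apply/integrableP; split; first exact: measurableT_comp.
  have /integrableP[_] := integrable_poly_normal_prob p m.
  rewrite -(ge0_integral_normal_law (f := abse \o (EFin \o horner p)) hX) //.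
    exact: measurableT_comp.
  by move=> x; exact: abse_ge0.
split => //; rewrite -gauss_meanE -[LHS](integral_distribution mp ip).
rewrite (integral_distribution_normal _ hX) integral_pushforward//.
exact: integrable_poly_normal_prob.
Qed.

Lemma pushforward_pair_indep (d : nat) (y : 'I_d -> {mfun T >-> R}) i j :
  mutually_independent P y -> i != j -> forall C, measurable C ->
  P ((fun w => (y i w, y j w)) @^-1` C) =
  (distribution P (y i) \x distribution P (y j))%E C.
Proof.
move=> ind ij C mC; symmetry.
have mZ : measurable_fun setT (fun w => (y i w, y j w)).
  exact: measurable_fun_pair.
pose Z : {mfun T >-> (R * R)%type} := HB.pack (fun w => (y i w, y j w))
  (isMeasurableFun.Build _ _ _ _ _ mZ).
apply: (@product_measure_unique _ _ _ _ _ _ _ (distribution P Z)) => //.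
move=> A B mA mB.
pose S k := if k == i then A else B.
have := ind [set i; j]%SET S.
rewrite big_setU1 ?inE// big_set1 /S eqxx eq_sym (negbTE ij).
move=> <-; last by move=> k _; case: ifP.
congr (P _); apply/seteqP; split => w /=.
  move=> [Aw Bw] k; rewrite !inE => /orP[/eqP->|/eqP->]; first by rewrite eqxx.
  by rewrite eq_sym (negbTE ij).
move=> h; split.
  by have := h i; rewrite eqxx; apply; rewrite !inE eqxx.
by have := h j; rewrite eq_sym (negbTE ij); apply; rewrite !inE eqxx orbT.
Qed.

Lemma has_mean_indep (d : nat) (y : 'I_d -> {mfun T >-> R}) i j mi mj p q :
  mutually_independent P y -> i != j ->
  has_normal_law P mi 1 (y i) -> has_normal_law P mj 1 (y j) ->
  has_mean P (fun w => p.[y i w] * q.[y j w]) (gauss_mean mi p * gauss_mean mj q).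
Proof.
move=> ind ij hi hj.
have mZ : measurable_fun setT (fun w => (y i w, y j w)).
  exact: measurable_fun_pair.
pose Z : {mfun T >-> (R * R)%type} := HB.pack (fun w => (y i w, y j w))
  (isMeasurableFun.Build _ _ _ _ _ mZ).
have ZE C : measurable C -> distribution P Z C =
    (distribution P (y i) \x distribution P (y j))%E C.
  exact: pushforward_pair_indep.
pose f (u : R * R) : \bar R := (p.[u.1] * q.[u.2])%:E.
have mf : measurable_fun setT f.
  apply/measurable_EFinP; apply: measurable_funM.
    by apply: measurableT_comp => //; exact: measurable_poly.
  by apply: measurableT_comp => //; exact: measurable_poly.
have [ip pE] := has_mean_normal_law p hi.
have [iq qE] := has_mean_normal_law q hj.
have mp r : measurable_fun setT (EFin \o horner r : R -> \bar R).
  by apply/measurable_EFinP; exact: measurable_poly.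
have mabs r : measurable_fun setT (fun x : R => (`|r.[x]|)%:E).
  apply/measurable_EFinP; apply: measurableT_comp => //.
  exact: measurable_poly.
have ip' : (distribution P (y i)).-integrable setT (EFin \o horner p).
  exact: integrable_pushforward.
have iq' : (distribution P (y j)).-integrable setT (EFin \o horner q).
  exact: integrable_pushforward.
have pE' : (\int[distribution P (y i)]_x (p.[x])%:E = (gauss_mean mi p)%:E)%E.
  by rewrite -pE -[RHS](integral_distribution (mp p) ip).
have qE' : (\int[distribution P (y j)]_x (q.[x])%:E = (gauss_mean mj q)%:E)%E.
  by rewrite -qE -[RHS](integral_distribution (mp q) iq).
have fi : (distribution P (y i) \x distribution P (y j))%E.-integrable setT f.
  apply/integrable12ltyP => //.
  under eq_integral => x _.
    under eq_integral do rewrite /f /= normrM EFinM.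
    rewrite ge0_integralZl//.
    over.
  rewrite ge0_integralZr//; last exact: integral_ge0.
  have /integrableP[_ ip1] := ip'; have /integrableP[_ iq1] := iq'.
  by apply: lte_mul_pinfty => //; rewrite ?ge0_fin_numE ?integral_ge0.
have fZ : P.-integrable setT (f \o Z).
  apply/integrableP; split; first exact: measurableT_comp.
  have /integrableP[_] := fi; congr (_ < _)%E.
  rewrite -(ge0_integral_distribution Z (f := abse \o f))//.
  - by symmetry; apply: eq_measure_integral => C mC _; exact: ZE.
  - exact: measurableT_comp.
  - by move=> u; exact: abse_ge0.
split => //.
rewrite -[LHS](integral_distribution mf fZ).
transitivity (\int[distribution P (y i) \x distribution P (y j)]_u f u)%E.
  by apply: eq_measure_integral => C mC _; exact: ZE.
rewrite -integral12_prod_meas1// /fubini_F.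
under eq_integral => x _.
  under eq_integral do rewrite /f /= EFinM.
  rewrite (integralZl measurableT iq') qE'.
  over.
by rewrite (integralZr measurableT ip') pE' EFinM.
Qed.

End gaussian_means.

Section risk.
Variable R : realType.

(* Bias-variance decomposition: the cross terms vanish by independence. *)
Lemma has_mean_sqr_sum (disp : measure_display) (T : measurableType disp)
    (P : probability T R) (d : nat) (y : 'I_d -> {mfun T >-> R})
    (m : 'I_d -> R) (r : 'I_d -> {poly R}) (b : R) :
  mutually_independent P y -> (forall i, has_normal_law P (m i) 1 (y i)) ->
  (forall i, gauss_mean (m i) (r i) = 0) ->
  has_mean P (fun w => (\sum_(i < d) (r i).[y i w] + b) ^+ 2)
    (\sum_(i < d) gauss_mean (m i) (r i ^+ 2) + b ^+ 2).
Proof.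
move=> ind ny r0.
pose s w := \sum_(i < d) (r i).[y i w].
have -> : (fun w => (s w + b) ^+ 2) = fun w =>
    \sum_(i < d) \sum_(j < d) (r i).[y i w] * (r j).[y j w] +
    (2 * b * s w + b ^+ 2).
  apply/funext => w.
  under eq_bigr => i _ do rewrite -mulr_sumr.
  by rewrite -mulr_suml -/(s w); ring.
have -> : \sum_(i < d) gauss_mean (m i) (r i ^+ 2) + b ^+ 2 =
    \sum_(i < d) \sum_(j < d) (if i == j then gauss_mean (m i) (r i ^+ 2) else 0)
    + (2 * b * (\sum_(i < d) gauss_mean (m i) (r i)) + b ^+ 2).
  rewrite [X in 2 * b * X]big1// mulr0 add0r; congr (_ + _).
  apply: eq_bigr => i _; rewrite -big_mkcond /=.
  by under eq_bigl => j do rewrite eq_sym; rewrite big_pred1_eq.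
apply: has_meanD; last first.
  apply: has_meanD; last exact: has_mean_cst.
  apply: has_meanZ; apply: has_mean_sum => i _.
  exact: has_mean_normal_law.
apply: has_mean_sum => i _; apply: has_mean_sum => j _.
have [<-|ij] := eqVneq i j.
  have -> : (fun w => (r i).[y i w] * (r i).[y i w]) =
      fun w => (r i ^+ 2).[y i w].
    by apply/funext => w; rewrite expr2 hornerM.
  exact: has_mean_normal_law.
rewrite -[0](mulr0 (gauss_mean (m i) (r i))) -[X in _ * X](r0 j).
exact: has_mean_indep.
Qed.

Lemma gauss_variance_le (m a : R) (q : {poly R}) :
  gauss_mean m ((q - (gauss_mean m q)%:P) ^+ 2)
  <= gauss_mean m ((q - a%:P) ^+ 2).
Proof.
have H b : gauss_mean m ((q - b%:P) ^+ 2) =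
    gauss_mean m (q ^+ 2) - 2 * b * gauss_mean m q + b ^+ 2.
  have -> : (q - b%:P) ^+ 2 = q ^+ 2 - (2 * b) *: q + (b ^+ 2)%:P.
    by rewrite -!mul_polyC polyCM polyC_exp -[2%:P]/(2%:R%:P) polyC_natr; ring.
  by rewrite gauss_meanD gauss_meanB gauss_meanZ gauss_meanC.
rewrite !H -subr_ge0.
have -> : forall x u : R, x - 2 * a * u + a ^+ 2 - (x - 2 * u * u + u ^+ 2)
    = (u - a) ^+ 2 by move=> x u; ring.
exact: sqr_ge0.
Qed.

(* With [L = log d] and [r = L / M^2 >= 1] one has [n <= c L / (1 + log r)],
   hence [(1 + sqrt n / M)^n <= (e r)^n <= exp (c L)]. *)
Lemma degree_growth_bound (c L M : R) (n : nat) :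
  0 < c -> c <= 1 -> 0 < M -> M ^+ 2 <= L ->
  n%:R <= c * L / ln (expR 1 * L / M ^+ 2) ->
  expR (2 * n%:R) * (1 + Num.sqrt n%:R / M) ^+ n <= expR (3 * c * L).
Proof.
move=> c0 c1 M0 ML; set r := L / M ^+ 2.
have M20 : 0 < M ^+ 2 by exact: exprn_gt0.
have L0 : 0 < L by exact: lt_le_trans ML.
have r1 : 1 <= r by rewrite ler_pdivlMr// mul1r.
have r0 : 0 < r by exact: lt_le_trans r1.
have e2 : 2 <= expR 1 :> R by have := @expR_ge1Dx R 1.
have er0 : 0 < expR 1 * r by rewrite mulr_gt0 ?expR_gt0.
have lnr0 : 0 <= ln r by exact: ln_ge0.
have -> : ln (expR 1 * L / M ^+ 2) = 1 + ln r.
  by rewrite -mulrA lnM ?posrE ?expR_gt0// expRK.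
have l0 : 0 < 1 + ln r by rewrite ltr_pwDl.
rewrite ler_pdivlMr// => nK.
have n0 : 0 <= n%:R :> R by [].
have nL : n%:R <= c * L.
  by apply: le_trans nK; rewrite ler_peMr// lerDl.
have M0' := ltW M0.
have sM0 : 0 <= Num.sqrt n%:R / M by rewrite divr_ge0.
have sr : Num.sqrt n%:R / M <= r.
  rewrite -(@ler_pXn2r _ 2) ?nnegrE ?(ltW r0)//.
  rewrite expr_div_n sqr_sqrtr//.
  apply: (@le_trans _ _ r); last by rewrite expr2 ler_peMr// ltW.
  rewrite ler_pM2r ?invr_gt0//; apply: le_trans nL _.
  by rewrite ler_piMl// ltW.
have -> : 3 * c * L = 2 * (c * L) + c * L by ring.
rewrite expRD; apply: ler_pM; rewrite ?expR_ge0 ?exprn_ge0 ?addr_ge0 ?(ltW er0)//.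
  by rewrite ler_expR ler_pM2l.
apply: (@le_trans _ _ ((expR 1 * r) ^+ n)).
  rewrite lerXn2r ?nnegrE ?addr_ge0 ?(ltW er0)//.
  apply: (@le_trans _ _ (2 * r)); last by rewrite ler_pM2r.
  have -> : 2 * r = r + r by ring.
  exact: lerD.
rewrite -[expR 1 * r]lnK ?posrE// -expRM_natl ler_expR.
by rewrite lnM ?posrE ?expR_gt0// expRK.
Qed.

End risk.

(** * Upper bound on the risk *)

Section upper_bound.
Variable R : realType.

Lemma normr_coord_le (d : nat) (v : 'rV[R]_d) i : `|v ord0 i| <= `|v|.
Proof.
have /mapP[j _ ->] : `|v ord0 i| \in [seq `|v x.1 x.2| | x : 'I_1 * 'I_d].
  by apply/mapP; exists (ord0, i) => //=; rewrite mem_enum.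
by rewrite [leRHS]/Num.norm /= mx_normrE; apply/bigmax_geP; right => /=; exists j.
Qed.

Lemma sup_norm_ub (M : R) (g : R -> R) x : `|x| <= M ->
  ((`|g x|)%:E <= sup_norm M g)%E.
Proof. by move=> xM; apply: ereal_sup_ubound; exists x. Qed.

Lemma degree_at_mostE (K : R) (p : {poly R}) : 0 <= K ->
  degree_at_most K p -> (size p <= (Num.truncn K).+1)%N.
Proof.
move=> K0; rewrite /degree_at_most /= -truncn_ge_nat//.
by case: (size p).
Qed.

Lemma best_approximation_error (K M a : R) F (p : {poly R}) :
  0 <= K -> 0 < M -> best_approximation K M F p ->
  (sup_norm M (fun x => F x - F 0)%R <= a%:E)%E ->
  exists delta : R, [/\ approx_error M F p = delta%:E, 0 <= delta & delta <= a].
Proof.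
move=> K0 M0 [_ best] Fa.
have da : (approx_error M F p <= a%:E)%E.
  apply: le_trans (best (F 0)%:P _) _.
    by rewrite /degree_at_most /=; apply: le_trans K0; rewrite size_polyC; case: eqP.
  apply: le_trans Fa; rewrite /approx_error.
  by under eq_fun do rewrite hornerC.
have d0 : (0 <= approx_error M F p)%E.
  have := @sup_norm_ub M (fun x => F x - p.[x]) 0.
  by rewrite normr0 => /(_ (ltW M0)); apply: le_trans; rewrite lee_fin.
case: (approx_error M F p) da d0 => [r| |]//; rewrite !lee_fin => ra r0.
by exists r.
Qed.

Lemma risk_bound (eps1 eps2 C1 C2 c L delta : R) :
  0 < C1 -> 0 < C2 -> 6 * c + 2 * (eps1 + eps2) <= 1 -> 0 <= L -> 0 <= delta ->
  1 <= delta * (C2 * expR (eps2 * L)) ->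
  expR L * (2 * C1 * expR (eps1 * L) * expR (3 * c * L)) ^+ 2
    + (expR L * delta) ^+ 2
  <= (1 + 4 * C1 ^+ 2 * C2 ^+ 2) * expR L ^+ 2 * delta ^+ 2.
Proof.
move=> C10 C20 hc L0 d0 hd.
set D := expR L; have D0 : 0 <= D := expR_ge0 _.
set e1 := expR (eps1 * L); set e2 := expR (eps2 * L) in hd *.
set e3 := expR (3 * c * L).
have eD : e1 ^+ 2 * e2 ^+ 2 * e3 ^+ 2 <= D.
  rewrite -!expRM_natl -!expRD ler_expR.
  have -> : 2 * (eps1 * L) + 2 * (eps2 * L) + 2 * (3 * c * L) =
    (6 * c + 2 * (eps1 + eps2)) * L by ring.
  by rewrite ler_piMl.
have hd2 : 1 <= (delta * (C2 * e2)) ^+ 2 by rewrite exprn_ege1.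
have -> : (1 + 4 * C1 ^+ 2 * C2 ^+ 2) * D ^+ 2 * delta ^+ 2 =
  D * (4 * C1 ^+ 2 * C2 ^+ 2 * delta ^+ 2) * D + (D * delta) ^+ 2 by ring.
rewrite lerD2r.
apply: (@le_trans _ _
  (D * (2 * C1 * e1 * e3) ^+ 2 * (delta * (C2 * e2)) ^+ 2)).
  by rewrite ler_peMr// mulr_ge0// sqr_ge0.
have -> : D * (2 * C1 * e1 * e3) ^+ 2 * (delta * (C2 * e2)) ^+ 2 =
  D * (4 * C1 ^+ 2 * C2 ^+ 2 * delta ^+ 2) * (e1 ^+ 2 * e2 ^+ 2 * e3 ^+ 2) by ring.
by apply: ler_wpM2l => //; rewrite !mulr_ge0// ltW.
Qed.

End upper_bound.

Theorem theorem2 (R : realType) :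
  exists c0 : R -> R, exists C3 : R -> R -> R,
  forall eps1 eps2 C1 C2 : R,
    0 <= eps1 -> 0 <= eps2 -> 2 * eps1 + 2 * eps2 < 1 -> 0 < C1 -> 0 < C2 ->
    0 < c0 (eps1 + eps2) /\ 0 < C3 C1 C2 /\
    forall c : R, 0 < c -> c <= c0 (eps1 + eps2) ->
    forall (d : nat) (M : R), (0 < d)%N -> 0 < M -> M <= Num.sqrt (ln d%:R) ->
    let K := c * ln d%:R / ln (expR 1 * ln d%:R / M ^+ 2) in
    forall (F : R -> R) (PK : {poly R}),
      best_approximation K M F PK ->
      let delta := approx_error M F PK in
      (sup_norm M (fun x => F x - F 0)%R <= (C1 * d%:R `^ eps1)%:E)%E ->
      (delta^-1 <= (C2 * d%:R `^ eps2)%:E)%E ->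
    forall (disp : measure_display) (T : measurableType disp)
      (P : 'rV[R]_d -> probability T R) (y : 'I_d -> {mfun T >-> R}),
      gaussian_sequence_model P y ->
      (ereal_sup [set 'E_(P theta)[fun w =>
           ((additive_estimator K PK (fun i => y i w)
             - additive_functional F theta) ^+ 2)%R]
         | theta in parameter_space d M]
       <= (C3 C1 C2)%:E * (d%:R ^+ 2)%:E * delta ^+ 2)%E.
Proof.
exists (fun s => (1 - 2 * s) / 6), (fun a b => 1 + 4 * a ^+ 2 * b ^+ 2).
move=> eps1 eps2 C1 C2 e1 e2 e12 C10 C20; split; first by lra.
split; first by rewrite ltr_pwDl// !mulr_ge0// ltW.
move=> c c0 cle d M d0 M0 ML K F PK best delta hF hdelta disp T P y model.
pose L : R := ln d%:R; rewrite -/L in ML.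
have c1 : c <= 1 by lra.
have hc : 6 * c + 2 * (eps1 + eps2) <= 1 by lra.
have L0 : 0 < L.
  by rewrite -sqrtr_gt0; exact: lt_le_trans ML.
have ML2 : M ^+ 2 <= L.
  by rewrite -[leRHS]sqr_sqrtr ?(ltW L0)// lerXn2r ?nnegrE ?sqrtr_ge0 ?(ltW M0).
have dR0 : 0 < d%:R :> R by rewrite ltr0n.
have dE : d%:R = expR L :> R by rewrite lnK.
have powE a : d%:R `^ a = expR (a * L) by rewrite dE -expRM mulrC.
have K0 : 0 <= K.
  rewrite /K -/L divr_ge0 ?mulr_ge0 ?(ltW L0) ?(ltW c0)//.
  apply: ln_ge0; rewrite ler_pdivlMr ?exprn_gt0// mul1r.
  apply: le_trans ML2 _; rewrite ler_peMl ?(ltW L0)//.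
  by apply: le_trans (expR_ge1Dx 1); rewrite lerDl.
rewrite !powE in hF hdelta.
have [del [delE del0 delC]] := best_approximation_error K0 M0 best hF.
rewrite -/delta in delE; rewrite delE in hdelta *.
have {hdelta} hdel : 1 <= del * (C2 * expR (eps2 * L)).
  move: hdelta; rewrite inver; case: eqVneq => [_|dn0]; first by rewrite leye_eq.
  have dp : 0 < del by rewrite lt_def dn0.
  by rewrite lee_fin => h; rewrite -ler_pdivrMl// mulr1.
have PF x : `|x| <= M -> `|F x - PK.[x]| <= del.
  move=> xM; rewrite -lee_fin -delE.
  exact: (sup_norm_ub (fun x => F x - PK.[x])).
set A := 2 * C1 * expR (eps1 * L).
have PA x : `|x| <= M -> `|(PK - (F 0)%:P).[x]| <= A.
  move=> xM; rewrite hornerD hornerN hornerC.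
  have -> : PK.[x] - F 0 = (F x - F 0) - (F x - PK.[x]) by ring.
  apply: le_trans (ler_normB _ _) _.
  have -> : A = C1 * expR (eps1 * L) + C1 * expR (eps1 * L) by rewrite /A; ring.
  apply: lerD; last by apply: le_trans delC; exact: PF.
  rewrite -lee_fin; apply: le_trans hF.
  exact: (sup_norm_ub (fun x => F x - F 0)).
pose n := Num.truncn K.
have sP : (size PK <= n.+1)%N by apply: degree_at_mostE => //; case: best.
have sPF : (size (PK - (F 0)%:P)%R <= n.+1)%N.
  apply: leq_trans (size_polyD _ _) _; rewrite geq_max sP size_polyN size_polyC.
  by case: eqP.
have nK : n%:R <= K by rewrite truncn_le.
apply: ge_ereal_sup => _ [theta thetaM <-].
have thM i : `|theta ord0 i| <= M by exact: le_trans (normr_coord_le _ _) thetaM.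
have [ind law] := model theta.
pose q := hermite_transform_poly n.+1 PK.
pose r i := q - (PK.[theta ord0 i])%:P.
have qE i : gauss_mean (theta ord0 i) q = PK.[theta ord0 i].
  exact: gauss_mean_hermite_transform.
have r0 i : gauss_mean (theta ord0 i) (r i) = 0.
  by rewrite gauss_meanB qE gauss_meanC subrr.
pose b := \sum_(i < d) (PK.[theta ord0 i] - F (theta ord0 i)).
have bdel : `|b| <= d%:R * del.
  apply: le_trans (ler_norm_sum _ _ _) _.
  apply: (@le_trans _ _ (\sum_(i < d) del)).
    by apply: ler_sum => i _; rewrite distrC; exact: PF.
  by rewrite sumr_const card_ord mulr_natl.
have rv i : gauss_mean (theta ord0 i) (r i ^+ 2) <= (A * expR (3 * c * L)) ^+ 2.
  rewrite /r -qE; apply: le_trans (gauss_variance_le _ (F 0) _) _.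
  have -> : q - (F 0)%:P = hermite_transform_poly n.+1 (PK - (F 0)%:P).
    by rewrite -polyCN hermite_transform_polyD hermite_transform_polyC polyCN.
  apply: le_trans (hermite_transform_sqr_bound sPF M0 (thM i) PA) _.
  have A0 : 0 <= A by rewrite !mulr_ge0 ?expR_ge0 ?ltW.
  rewrite -mulrA lerXn2r ?nnegrE ?mulr_ge0 ?expR_ge0 ?exprn_ge0 ?addr_ge0
    ?divr_ge0 ?sqrtr_ge0 ?(ltW M0) ?(ltW C10)//.
  by apply: ler_wpM2l => //; exact: degree_growth_bound.
have hm := has_mean_sqr_sum b ind law r0.
have -> : (fun w => ((additive_estimator K PK (fun i => y i w)
    - additive_functional F theta) ^+ 2)%R) =
    (fun w => (\sum_(i < d) (r i).[y i w] + b) ^+ 2).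
  apply/funext => w; congr (_ ^+ 2).
  rewrite /additive_estimator /additive_functional /b -big_split -sumrB /=.
  apply: eq_bigr => i _; rewrite hermite_transformE -/n -/q /r.
  by rewrite hornerD hornerN hornerC addrA subrK.
rewrite (expectation_has_mean hm) -!EFin_expe -!EFinM lee_fin.
rewrite dE; apply: (le_trans _ (risk_bound C10 C20 hc (ltW L0) del0 hdel)).
rewrite -dE; apply: lerD.
  rewrite -/A mulr_natl -[in leRHS](card_ord d) -sumr_const.
  by apply: ler_sum => i _; exact: rv.
by rewrite -[leLHS]real_normK ?num_real// lerXn2r ?nnegrE ?mulr_ge0.
Qed.
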